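(* Assume monotone protection. Then the union of any nonempty family of self-protecting coalitions is self-protecting; hence $C^+(S)$, the union of all self-protecting coalitions, is the unique largest self-protecting coalition. Moreover, any permission-respecting release rule that satisfies regret-free safety can expand the public coalition only to a subset of $C^+(S)$: on every admissible realization and at every date $t$, the public coalition $C_t$ satisfies $C_t\subseteq C^+(S)$.
   Context: Setting. $C_0$ (the vanguard, possibly empty) and $N$ are disjoint finite sets of people; $S\subseteq N$ is the set of supporters. A coalition is a set $C$ with $C_0\subseteq C\subseteq C_0\cup S$. For each $i\in C_0\cup S$ a protection family $\mathcal P_i$ is given, consisting of coalitions that contain $i$; $C$ protects $i$ if $C\in\mathcal P_i$. Standing assumption: $C_0\in\mathcal P_i$ for every $i\in C_0$. Monotone protection: for all $i$ and all coalitions $C\subseteq C'$ with $C\in\mathcal P_i$ (so $i\in C'$), also $C'\in\mathcal P_i$. A coalition $C$ is self-protecting if $C\in\mathcal P_i$ for every $i\in C$. Define $C^+(S)=\bigcup\{C: C_0\subseteq C\subseteq C_0\cup S,\ C\text{ self-protecting}\}$. A release rule produces, on each admissible realization, a nondecreasing sequence of public sets $C_0\subseteq C_1\subseteq C_2\subseteq\cdots$. It is permission-respecting if it publishes no name without that agent's permission, so that always $C_t\subseteq C_0\cup S$. It satisfies regret-free safety if for every date $t$, every admissible realization, and every $i\in C_t$, $C_t\in\mathcal P_i$. *)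

(* Defs.v *)
From mathcomp Require Import all_boot.

Set Implicit Arguments.
Unset Strict Implicit.
Unset Printing Implicit Defensive.

(* [T] is an ambient finite type of people; the vanguard [C0], the pool [N] and
   the supporters [S] are subsets of it.  [P i] is the protection family of
   person [i]; its value is meaningful only for [i \in C0 :|: S]. *)

Definition coalition (T : finType) (C0 S C : {set T}) : bool :=
  (C0 \subset C) && (C \subset C0 :|: S).

Definition protection_families (T : finType) (C0 S : {set T})
    (P : T -> {set {set T}}) : Prop :=
  forall i, i \in C0 :|: S ->
  forall C, C \in P i -> coalition C0 S C /\ i \in C.

Definition monotone_protection (T : finType) (C0 S : {set T})
    (P : T -> {set {set T}}) : Prop :=
  forall i, i \in C0 :|: S ->
  forall C C' : {set T}, coalition C0 S C -> coalition C0 S C' ->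
  C \subset C' -> C \in P i -> C' \in P i.

Definition self_protecting (T : finType) (C0 S : {set T})
    (P : T -> {set {set T}}) (C : {set T}) : bool :=
  coalition C0 S C && [forall i in C, C \in P i].

Definition Cplus (T : finType) (C0 S : {set T})
    (P : T -> {set {set T}}) : {set T} :=
  \bigcup_(C : {set T} | self_protecting C0 S P C) C.

Definition largest_self_protecting (T : finType) (C0 S : {set T})
    (P : T -> {set {set T}}) (D : {set T}) : Prop :=
  self_protecting C0 S P D /\
  forall C : {set T}, self_protecting C0 S P C -> C \subset D.

(* [Omega] is an arbitrary type of realizations, [adm] selects the admissible
   ones, and [rule w t] is the public set at date [t] on realization [w]; the
   public set at date 0 is the vanguard. *)

Definition release_rule (T : finType) (C0 : {set T}) (Omega : Type)
    (adm : Omega -> Prop) (rule : Omega -> nat -> {set T}) : Prop :=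
  forall w, adm w ->
  rule w 0 = C0 /\ forall t, rule w t \subset rule w t.+1.

Definition permission_respecting (T : finType) (C0 S : {set T}) (Omega : Type)
    (adm : Omega -> Prop) (rule : Omega -> nat -> {set T}) : Prop :=
  forall w, adm w -> forall t, rule w t \subset C0 :|: S.

Definition regret_free_safe (T : finType) (P : T -> {set {set T}})
    (Omega : Type) (adm : Omega -> Prop) (rule : Omega -> nat -> {set T}) :
    Prop :=
  forall t w, adm w -> forall i, i \in rule w t -> rule w t \in P i.

(* Main.v *)
Require Import Defs.
From mathcomp Require Import all_boot.

(** A member of a union of self-protecting coalitions is already protected by the one it comes from,
    and monotonicity carries that protection up to the union ([self_protecting_bigcup]). The
    vanguard is itself self-protecting, so this applies to the family of all self-protecting
    coalitions: [Cplus] belongs to that family and, being its union, is its maximum. A safe release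
    rule publishes only self-protecting coalitions, and each of these is one of the sets united in
    [Cplus]. *)

Lemma self_protecting_bigcup (T : finType) (C0 S : {set T})
    (P : T -> {set {set T}}) (F : {set {set T}}) :
  monotone_protection C0 S P -> F != set0 ->
  (forall C, C \in F -> self_protecting C0 S P C) ->
  self_protecting C0 S P (\bigcup_(C in F) C).
Proof.
move=> monoP /set0Pn[A AF] spF.
have coalF C : C \in F -> coalition C0 S C by move=> /spF /andP[].
have coalU : coalition C0 S (\bigcup_(C in F) C).
  apply/andP; split; last by apply/bigcupsP => C /coalF /andP[].
  (* Nonemptiness matters here: the empty union is [set0], which need not contain [C0]. *)
  have /andP[C0A _] := coalF A AF.
  exact: subset_trans C0A (bigcup_sup A AF).
rewrite /self_protecting coalU /=.
apply/forall_inP => i /bigcupP[C CF iC].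
have /andP[coalC /forall_inP protC] := spF C CF.
have /andP[_ /subsetP subC] := coalC.
(* [monoP] speaks only of people in [C0 :|: S]; [i] is one because the coalition [C] lies there. *)
exact: monoP (subC i iC) _ _ coalC coalU (bigcup_sup C CF) (protC i iC).
Qed.

Lemma sub_Cplus (T : finType) (C0 S : {set T}) (P : T -> {set {set T}})
    (C : {set T}) :
  self_protecting C0 S P C -> C \subset Cplus C0 S P.
Proof. by move=> spC; apply: bigcup_sup. Qed.

Lemma self_protecting_Cplus (T : finType) (C0 S : {set T})
    (P : T -> {set {set T}}) :
  monotone_protection C0 S P -> (forall i, i \in C0 -> C0 \in P i) ->
  self_protecting C0 S P (Cplus C0 S P).
Proof.
move=> monoP C0P.
(* The union over a predicate becomes one over a set of sets, the form that [self_protecting_bigcup]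
   takes. *)
have -> : Cplus C0 S P =
    \bigcup_(C in [set C | self_protecting C0 S P C]) C.
  by apply: eq_bigl => C; rewrite inE.
apply: self_protecting_bigcup => // [|C]; last by rewrite inE.
(* The vanguard witnesses nonemptiness: [C0P] says exactly that it protects all its members. *)
apply/set0Pn; exists C0; rewrite inE /self_protecting /coalition subxx subsetUl.
exact/forall_inP.
Qed.

(** Supplies the lower bound in [coalition]; permission supplies only the upper one. *)
Lemma release_rule_vanguard (T : finType) (C0 : {set T}) (Omega : Type)
    (adm : Omega -> Prop) (rule : Omega -> nat -> {set T}) w t :
  release_rule C0 adm rule -> adm w -> C0 \subset rule w t.
Proof.
move=> relR admw; have [rule0 ruleS] := relR w admw.
elim: t => [|t IHt]; first by rewrite rule0.
exact: subset_trans IHt (ruleS t).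
Qed.

Theorem theorem1 (T : finType) (C0 N S : {set T}) (P : T -> {set {set T}})
  (disjoint_C0N : [disjoint C0 & N])
  (sub_SN : S \subset N)
  (families_P : protection_families C0 S P)
  (vanguard_P : forall i, i \in C0 -> C0 \in P i)
  (monotone_P : monotone_protection C0 S P) :
  (forall F : {set {set T}}, F != set0 ->
     (forall C, C \in F -> self_protecting C0 S P C) ->
     self_protecting C0 S P (\bigcup_(C in F) C))
  /\ (largest_self_protecting C0 S P (Cplus C0 S P)
      /\ forall D, largest_self_protecting C0 S P D -> D = Cplus C0 S P)
  /\ (forall (Omega : Type) (adm : Omega -> Prop)
         (rule : Omega -> nat -> {set T}),
       release_rule C0 adm rule ->
       permission_respecting C0 S adm rule ->
       regret_free_safe P adm rule ->
       forall w, adm w -> forall t, rule w t \subset Cplus C0 S P).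
Proof.
split; first by move=> F; apply: self_protecting_bigcup.
have spCplus : self_protecting C0 S P (Cplus C0 S P).
  exact: self_protecting_Cplus.
split.
  split; first by split=> // C; apply: sub_Cplus.
  move=> D [spD maxD].
  by apply/eqP; rewrite eqEsubset sub_Cplus // maxD.
move=> Omega adm rule relR permR safeR w admw t.
(* It suffices that [rule w t] is self-protecting; regret-free safety is precisely the protection
   clause. *)
apply: sub_Cplus; rewrite /self_protecting /coalition.
rewrite (release_rule_vanguard _ _ _ _ _ w t relR admw) permR //=.
by apply/forall_inP => i; apply: safeR.
Qed.
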